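(* If a presentation $P$ satisfies condition $\tau'$ and has no proper powers (i.e. no relator of $P$ is a proper power in the free group on the generators), then $P$ is diagrammatically reducible (DR).
   Context: **Presentations and diagrams.** For a presentation $P=\langle X\mid R\rangle$ the relators are assumed cyclically reduced, and no relator is a cyclic permutation of another relator or of the inverse of another relator. $R^*$ is the set of all cyclic permutations of elements of $R$ and of their inverses. A piece is a word which is a common prefix of two different elements of $R^*$. $K_P$ is the standard $2$-complex of $P$. A diagram over $P$ is a combinatorial map $\varphi\colon M\to K_P$ (open cells map homeomorphically onto open cells), where $M$ is obtained from a combinatorial cell structure on the $2$-sphere by removing some (possibly none) open $2$-cells; it is a spherical, disk or annular diagram if respectively $0$, $1$, $2$ open $2$-cells are removed. $\partial M$ is the boundary of $M$ in the sphere. Cells of dimension $0,1,2$ are called vertices, edges, faces. Via $\varphi$, edges of $M$ are labeled by elements of $X$ and their inverses, and the boundary label of an oriented face, read from any vertex, is an element of $R^*$. A diagram is reducible if it contains two faces $f,f'$ such that $\partial f\cap\partial f'$ contains an edge $e$ for which the boundary labels of $f$ and $f'$, read with opposite orientations and starting at an endpoint of $e$ (traversing $e$ first), coincide; otherwise it is reduced. The degree $d(v)$ of a vertex $v$ is the number of edges incident to $v$ (loops counted twice). A vertex is interior if it is not in $\partial M$. **Convention.** In a reduced diagram, interior vertices of degree $2$ are removed (merging the two incident edges), so that interior edges are labeled by pieces; the length $\ell(e)$ of such an edge is the length of its label, i.e. the number of original edges glued to form it. **Condition $\tau'$.** A corner $c$ of a face $f$ at an interior vertex $v$ lies between two consecutive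 edges at $v$, of lengths $\ell_1(c),\ell_2(c)$; $\ell_r(c)$ is the length of the relator corresponding to $f$. Put $d'_F(v)=\sum_{c\ni v}\frac{\ell_1(c)+\ell_2(c)}{\ell_r(c)}$, the sum over all corners at $v$. $P$ satisfies $\tau'$ if $d'_F(v)\le d(v)-2$ for every interior vertex $v$ of every reduced diagram over $P$ (with no interior vertices of degree $2$). **DR.** A presentation $P$ with no proper powers is DR if all spherical diagrams over $P$ are reducible. *)

(* Defs.v *)
From mathcomp Require Import all_boot all_order all_algebra all_fingroup.

Set Implicit Arguments.
Unset Strict Implicit.
Unset Printing Implicit Defensive.

Import Order.TTheory GRing.Theory Num.Theory.

(** * Words and presentations *)

(* [(x, true)] is the generator [x], [(x, false)] is its inverse. *)
Definition letter (X : Type) : Type := (X * bool)%type.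
Definition word (X : Type) : Type := seq (letter X).

Definition linv (X : Type) (a : letter X) : letter X := (a.1, ~~ a.2).
Definition winv (X : Type) (w : word X) : word X := rev (map (@linv X) w).
Definition wexp (X : Type) (w : word X) (n : nat) : word X :=
  flatten (nseq n w).

Definition reduced_word (X : Type) (w : word X) : Prop :=
  forall (u v : word X) (a : letter X), w <> u ++ [:: a, linv a & v].

Definition cyclically_reduced (X : Type) (w : word X) : Prop :=
  forall k : nat, reduced_word (rot k w).

(* Words up to [free_eq] are the elements of the free group on [X]. *)
Inductive free_eq (X : Type) : word X -> word X -> Prop :=
| free_eq_refl w : free_eq w w
| free_eq_sym w w' : free_eq w w' -> free_eq w' w
| free_eq_trans w1 w2 w3 : free_eq w1 w2 -> free_eq w2 w3 -> free_eq w1 w3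
| free_eq_cancel u v a : free_eq (u ++ [:: a, linv a & v]) (u ++ v).

(* The identity counts as a proper power (1 = 1 ^ 2), so a presentation with
   no proper powers has no empty relator. *)
Definition proper_power (X : Type) (w : word X) : Prop :=
  exists (u : word X) (n : nat), 1 < n /\ free_eq w (wexp u n).

Record presentation : Type := Presentation {
  gen : Type;
  relator : word gen -> Prop;
  relator_cyclically_reduced :
    forall r, relator r -> cyclically_reduced r;
  relator_irredundant :
    forall r s, relator r -> relator s -> r <> s ->
    forall k : nat, s <> rot k r /\ s <> rot k (winv r)
}.

(* The set R^* *)
Definition symmetrized (P : presentation) (w : word (gen P)) : Prop :=
  exists (r : word (gen P)) (k : nat),
    relator r /\ (w = rot k r \/ w = rot k (winv r)).

Definition no_proper_powers (P : presentation) : Prop :=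
  forall r : word (gen P), relator r -> ~ proper_power r.

(** * Cell structures on the sphere *)

(* A cell structure on the oriented 2-sphere is encoded by its darts (oriented
   edges): [edge d] is [d] reversed, and [face d] is the dart following [d] on
   the boundary of the face lying to the left of [d].  Then [node d] is the
   dart next to [d] around the origin of [d].  Faces, edges and vertices are
   the cycles of these permutations, a vertex being the set of darts that
   start at it.  By Euler's formula the resulting closed connected surface is
   the sphere.  The only cell structure without darts (one vertex, one face)
   is left out: as a spherical diagram it needs an empty relator, and with its
   face removed it has no interior vertex and no face. *)
Definition node_perm (D : finType) (edge face : {perm D}) : {perm D} :=
  (face^-1 * edge)%g.

Record sphere : Type := Sphere {
  dart : finType;
  edge : {perm dart};
  face : {perm dart};
  edgeK : involutive edge;
  edge_neq : forall d, edge d != d;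
  sphere_connected :
    forall d d', connect [rel x y | (y == edge x) || (y == face x)] d d';
  sphere_euler :
    #|porbits (node_perm edge face)| + #|porbits face| = #|porbits edge| + 2
}.

Definition node (S : sphere) : {perm dart S} := node_perm (edge S) (face S).

Definition face_of (S : sphere) (d : dart S) : {set dart S} :=
  porbit (face S) d.
Definition origin (S : sphere) (d : dart S) : {set dart S} :=
  porbit (node S) d.
Definition vertices (S : sphere) : {set {set dart S}} := porbits (node S).

(* Label of the boundary of the face to the left of [d], read from [d] on. *)
Definition boundary_word (S : sphere) (X : Type) (lab : dart S -> letter X)
    (d : dart S) : word X :=
  map lab (traject (face S) d #|face_of d|).

(** * Diagrams *)

(* A combinatorial map to the standard 2-complex is given by its edge labels:
   as no relator is a cyclic permutation of another one or of its inverse, the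
   boundary label of a face determines the 2-cell it is mapped to. *)
Record diagram (P : presentation) : Type := Diagram {
  cells : sphere;
  removed : {set {set dart cells}};
  removed_faces : removed \subset porbits (face cells);
  label : dart cells -> letter (gen P);
  label_edge : forall d, label (edge cells d) = linv (label d);
  label_face : forall d, face_of d \notin removed ->
    symmetrized (boundary_word label d)
}.

Definition spherical (P : presentation) (M : diagram P) : Prop := removed M = set0.

(* If the face to the right of [d], read from [edge d], has label a^-1 u, then
   the last conjunct compares the label on the left of [d] with a u^-1. *)
Definition reducible (P : presentation) (M : diagram P) : Prop :=
  exists d : dart (cells M),
    let d' := edge (cells M) d in
    [/\ face_of d \notin removed M,
        face_of d' \notin removed M,
        face_of d != face_of d' &
        boundary_word (@label P M) d
          = winv (rot 1 (boundary_word (@label P M) d'))].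

Definition reduced (P : presentation) (M : diagram P) : Prop :=
  ~ reducible M.

(* [v] avoids the closures of the removed cells. *)
Definition interior (P : presentation) (M : diagram P)
    (v : {set dart (cells M)}) : bool :=
  [forall d in v, face_of d \notin removed M].

(* Each dart starting at [v] is one end of an edge at [v]. *)
Definition degree (P : presentation) (M : diagram P)
    (v : {set dart (cells M)}) : nat :=
  #|v|.

Definition erased (P : presentation) (M : diagram P)
    (v : {set dart (cells M)}) : bool :=
  interior v && (degree v == 2).

(* When [d] starts at a vertex that is not erased, this is the length of the
   edge that starts with [d] once the interior vertices of degree 2 have been
   removed: the glued edges are those met by going on from [d] for as long as
   the vertex reached is erased. *)
Definition edge_length (P : presentation) (M : diagram P)
    (d : dart (cells M)) : nat :=
  #|connect [rel x y | (y == face (cells M) x) && erased (origin y)] d|.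

Definition relator_length (P : presentation) (M : diagram P)
    (d : dart (cells M)) : nat :=
  size (boundary_word (@label P M) d).

(* The corners at [v] correspond to the darts [d] of [v]: the corner of [d]
   lies in the face to the left of [d], between [d] and [node d]. *)
Definition dF' (P : presentation) (M : diagram P)
    (v : {set dart (cells M)}) : rat :=
  (\sum_(d in v)
    ((edge_length d)%:R + (edge_length (node (cells M) d))%:R)
      / (relator_length d)%:R)%R.

Definition tau' (P : presentation) : Prop :=
  forall M : diagram P, reduced M ->
  forall v : {set dart (cells M)},
    v \in vertices (cells M) -> interior v -> degree v != 2 ->
    (dF' v <= (degree v)%:R - 2 :> rat)%R.

Definition DR (P : presentation) : Prop :=
  forall M : diagram P, spherical M -> reducible M.

(* Main.v *)
From mathcomp Require Import all_boot all_order all_algebra all_fingroup.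
From Stdlib Require Import Classical.
Require Import Defs.

(** The proof is a curvature count: distributing [d'_F] over the corners makes
    every face worth exactly [2], and Euler's formula forbids that together
    with condition tau'.

    Let [M] be a reduced spherical diagram, with [V] vertices, [E] edges and [F]
    faces; every vertex is interior.

    If some vertex has degree other than [2], connectedness puts a corner at
    such a vertex on the boundary of every face ([face_essential]).  The darts
    starting at these vertices then cut the boundary of each face into the
    glued edges ([unique_start]), so the glued edge lengths on a face [f] add up
    to the length of its relator.  Each glued edge of [f] is counted once at
    its first corner and once at its last corner, so the corners of [f]
    contribute [2], and the numbers [d'_F(v)] add up to [2F]
    ([sum_edge_length_left], [sum_edge_length_right]).  By tau' this is at most
    the sum of the [d(v) - 2], which equals [2E - 2V] since the removed vertices
    contribute [0] to it.  Hence [V - E + F <= 0], whereas it is [2].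

    If all vertices have degree [2], then [V = E] and so [F = 2]: two faces are
    glued along a circle.  Reading this circle from its two sides gives mirror
    boundary labels, so [M] is reducible ([all_bivalent_reducible]). *)

Set Implicit Arguments.
Unset Strict Implicit.
Unset Printing Implicit Defensive.

Import Order.TTheory GRing.Theory Num.Theory.

(** * Sums over the cycles of a permutation *)

Lemma sum_over_porbits (T : finType) (s : {perm T}) (F : T -> rat) :
  (\sum_x F x = \sum_(A in porbits s) \sum_(x in A) F x)%R.
Proof.
rewrite (partition_big (porbit s) (mem (porbits s))) /=; last first.
  by move=> x _; apply: imset_f.
apply: eq_bigr => A /imsetP[y _ ->]; apply: eq_bigl => x.
by rewrite eq_porbit_mem.
Qed.

Lemma sum_inv_card_porbit (T : finType) (s : {perm T}) :
  (\sum_x (#|porbit s x|%:R)^-1 = #|porbits s|%:R :> rat)%R.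
Proof.
rewrite (sum_over_porbits s) -sum1_card natr_sum.
apply: eq_bigr => A /imsetP[y _ ->].
rewrite (eq_bigr (fun=> (#|porbit s y|%:R)^-1)%R) => [|x]; last first.
  by rewrite -eq_porbit_mem => /eqP->.
rewrite !sumr_const -[LHS]mulr_natr mulVf // pnatr_eq0.
exact: card_porbit_neq0.
Qed.

Lemma sum_card_porbits (T : finType) (s : {perm T}) :
  (\sum_(A in porbits s) #|A|%:R = #|T|%:R :> rat)%R.
Proof.
rewrite -sum1_card natr_sum (sum_over_porbits s).
by apply: eq_bigr => A _; rewrite sumr_const.
Qed.

Lemma card_porbits_2 (T : finType) (s : {perm T}) :
  (forall x, #|porbit s x| = 2) -> #|T| = #|porbits s| * 2.
Proof.
move=> s2; apply/eqP; rewrite -(eqr_nat rat) natrM -(sum_card_porbits s).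
rewrite (eq_bigr (fun=> 2%:R)%R) => [|A /imsetP[x _ ->]]; last by rewrite s2.
by rewrite sumr_const mulr_natl.
Qed.

Lemma rev_traject (T : Type) (f g : T -> T) x n : cancel f g ->
  rev (traject g (iter n f x) n) = traject f (f x) n.
Proof.
move=> fK; elim: n => // n IH.
by rewrite trajectS rev_cons /= fK IH -/(traject f (f x) n.+1) trajectSr -iterSr.
Qed.

(** * Glued edges on the sphere *)

Section Sphere.
Variable S : sphere.
Implicit Types d x y : dart S.

Definition bivalent d := #|origin d| == 2.

(** In a spherical diagram every vertex is interior, so only bivalence decides
    whether a vertex is removed, and this set has size [edge_length d]. *)
Definition glued_edge d : pred (dart S) :=
  connect [rel x y | (y == face S x) && bivalent y] d.

Lemma node_face x : node S (face S x) = edge S x.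
Proof. by rewrite /node /node_perm permM permK. Qed.

Lemma face_edge_node x : face S (edge S (node S x)) = x.
Proof. by rewrite /node /node_perm permM edgeK permKV. Qed.

Lemma origin_node x : origin (node S x) = origin x.
Proof. exact: (porbit_perm (node S) 1). Qed.

Lemma origin_face x : origin (face S x) = origin (edge S x).
Proof. by rewrite -node_face origin_node. Qed.

Lemma face_of_face x : face_of (face S x) = face_of x.
Proof. exact: (porbit_perm (face S) 1). Qed.

Lemma bivalent_node x : bivalent (node S x) = bivalent x.
Proof. by rewrite /bivalent origin_node. Qed.

Lemma face_of_edge_node x : face_of (edge S (node S x)) = face_of x.
Proof. by rewrite -face_of_face face_edge_node. Qed.

(** At a vertex of degree [2] the two faces run along each other in opposite
    directions: walking past it on one side, then crossing the edge, amounts to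
    crossing first and then walking backwards. *)
Lemma face_edge_bivalent x : bivalent (face S x) ->
  face S (edge S (face S x)) = edge S x.
Proof.
move=> /eqP biv_x; have := iter_porbit (node S) (face S x).
rewrite -/(origin (face S x)) biv_x /= node_face => {1}<-.
by rewrite face_edge_node.
Qed.

Lemma glued_edge_face d x : glued_edge d x -> face_of x = face_of d.
Proof.
case/connectP=> p; elim: p d => [|y p IH] d /=; first by move=> _ ->.
by case/andP=> /andP[/eqP-> _] dp xp; rewrite (IH _ dp xp) face_of_face.
Qed.

(** By [face_edge_bivalent], walking past a vertex of degree [2] keeps the same
    face on the right as well. *)
Lemma glued_edge_face_edge d x :
  glued_edge d x -> face_of (edge S x) = face_of (edge S d).
Proof.
case/connectP=> p; elim: p d => [|y p IH] d /=; first by move=> _ ->.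
case/andP=> /andP[/eqP-> biv] dp xp; rewrite (IH _ dp xp).
by rewrite -face_of_face face_edge_bivalent.
Qed.

(** By connectedness: if the face of [x] has a vertex of degree other than [2],
    so has the face of [edge S x], since it runs along the same vertices until
    the first one of degree other than [2]. *)
Lemma face_essential d0 x : ~~ bivalent d0 ->
  exists2 d, ~~ bivalent d & face_of d = face_of x.
Proof.
move=> ess_d0; have := sphere_connected d0 x.
have edge_case n y : ~~ bivalent (iter n (face S) y) ->
    exists2 d, ~~ bivalent d & face_of d = face_of (edge S y).
  elim: n y => [|n IH] y.
    move=> ess_y; exists (face S (edge S y)); last exact: face_of_face.
    by rewrite /bivalent origin_face edgeK.
  rewrite iterSr; have [biv_fy | ess_fy _] := boolP (bivalent (face S y)).
    case/IH=> d ess_d dy; exists d; rewrite // dy.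
    by rewrite -face_of_face face_edge_bivalent.
  by exists (edge S y); rewrite // /bivalent -origin_face.
case/connectP=> p; have: exists2 d, ~~ bivalent d & face_of d = face_of d0.
  by exists d0.
elim: p {ess_d0} d0 => [|y p IH] d0 d0P /=; first by move=> _ ->.
case/andP=> d0y yp xp; apply: (IH y) => //; case: d0P => d ess_d dd0.
case/orP: d0y => /eqP-> {y yp xp IH}; last by exists d; rewrite ?face_of_face.
have: d \in porbit (face S) d0 by rewrite -eq_porbit_mem; apply/eqP.
by case/porbitP=> n dE; apply: (edge_case n); rewrite -permX -dE.
Qed.

(** The start of the glued edge through [x] is found by walking backwards
    around the face of [x] up to the first vertex of degree other than [2]. *)
Lemma unique_start d0 x : ~~ bivalent d0 ->
  exists2 d, ~~ bivalent d &
    forall d', ~~ bivalent d' -> glued_edge d' x = (d' == d).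
Proof.
move=> /(face_essential x)[c ess_c cx].
have: x \in porbit (face S) c by rewrite -eq_porbit_mem; apply/eqP.
case/porbitP=> n ->; rewrite permX; elim: n => [|n [d ess_d dP]] /=.
  exists c => // d' ess_d'; apply/idP/eqP => [|->]; last exact: connect0.
  case/connectP=> p; case/lastP: p => [|p z] //=.
  by rewrite rcons_path last_rcons => /andP[_ /andP[_ biv]] cz;
  rewrite cz biv in ess_c.
set y := iter n _ c in dP *.
have [biv_fy | ess_fy] := boolP (bivalent (face S y)).
  exists d => // d' ess_d'; rewrite -dP //; apply/idP/idP.
    case/connectP=> p; case/lastP: p => [|p z] /=.
      by move=> _ fyd; rewrite -fyd biv_fy in ess_d'.
    rewrite rcons_path last_rcons => /andP[d'p /andP[/eqP-> _]] /perm_inj yE.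
    by apply/connectP; exists p.
  by move=> d'y; apply: connect_trans d'y (connect1 _); rewrite /= eqxx.
exists (face S y) => // d' ess_d'; apply/idP/eqP => [|->]; last exact: connect0.
case/connectP=> p; case/lastP: p => [|p z] //=.
by rewrite rcons_path last_rcons => /andP[_ /andP[_ biv]] cz;
  rewrite cz biv in ess_fy.
Qed.

Lemma sum_over_glued_edges d0 (F : dart S -> rat) : ~~ bivalent d0 ->
  (\sum_(d | ~~ bivalent d) \sum_(x | glued_edge d x) F x = \sum_x F x)%R.
Proof.
move=> ess_d0; rewrite (exchange_big_dep predT) //=.
apply: eq_bigr => x _; have [d ess_d dP] := unique_start x ess_d0.
rewrite (big_pred1 d) // => d' /=.
have [/dP //|biv_d'] := boolP (~~ bivalent d').
by apply/esym/negbTE; apply: contraNneq biv_d' => ->.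
Qed.

(** On each face the glued edges are counted once at their first corner. *)
Lemma sum_edge_length_left d0 : ~~ bivalent d0 ->
  (\sum_(d | ~~ bivalent d) #|glued_edge d|%:R / #|face_of d|%:R
     = #|porbits (face S)|%:R :> rat)%R.
Proof.
move=> ess_d0; rewrite -sum_inv_card_porbit -(sum_over_glued_edges _ ess_d0).
apply: eq_bigr => d _; rewrite (eq_bigr (fun=> (#|face_of d|%:R)^-1)%R) => [|x].
  by rewrite sumr_const mulr_natl.
by move/glued_edge_face=> <-.
Qed.

(** On each face the glued edges are counted once at their last corner: the
    glued edge that starts with [node S d] is the one that precedes [d] around
    the face of [d], with opposite orientation. *)
Lemma sum_edge_length_right d0 : ~~ bivalent d0 ->
  (\sum_(d | ~~ bivalent d) #|glued_edge (node S d)|%:R / #|face_of d|%:R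
     = #|porbits (face S)|%:R :> rat)%R.
Proof.
move=> ess_d0; rewrite -sum_inv_card_porbit [RHS](reindex_inj (@perm_inj _ (edge S))).
rewrite -(sum_over_glued_edges _ ess_d0); rewrite [RHS](reindex_inj (@perm_inj _ (node S))).
apply: eq_big => d; first by rewrite bivalent_node.
move=> _; rewrite (eq_bigr (fun=> (#|face_of d|%:R)^-1)%R) => [|x].
  by rewrite sumr_const mulr_natl.
by move/glued_edge_face_edge; rewrite face_of_edge_node => <-.
Qed.

Lemma card_darts : #|dart S| = #|porbits (edge S)| * 2.
Proof.
apply: card_porbits_2 => x; set s := edge S.
rewrite (_ : porbit s x = [set x; s x]); first by rewrite cards2 eq_sym edge_neq.
apply/setP=> y; rewrite !inE; apply/porbitP/orP => [[n ->]|]; last first.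
  by case=> /eqP->; [exists 0 | exists 1]; rewrite ?expg0 ?perm1.
rewrite permX; elim: n => [|n IH] /=; first by left.
by case: IH => /eqP->; [right | left; rewrite edgeK].
Qed.

End Sphere.

(** * Spherical diagrams *)

Section SphericalDiagram.
Variables (P : presentation) (M : diagram P).
Hypothesis sphM : spherical M.
Implicit Types d x : dart (cells M).

Lemma not_removed d : face_of d \notin removed M.
Proof. by rewrite sphM inE. Qed.

Lemma interiorT (v : {set dart (cells M)}) : interior v.
Proof. by apply/forall_inP => d _; apply: not_removed. Qed.

Lemma edge_length_glued d : edge_length d = #|glued_edge d|.
Proof.
by apply/eq_card/eq_connect => x y; rewrite /= /erased interiorT.
Qed.

Lemma relator_length_face d : relator_length d = #|face_of d|.
Proof. by rewrite /relator_length /boundary_word size_map size_traject. Qed.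

(** Corners sit at darts, so summing over vertices and then over the corners at
    each vertex splits into one sum for each end of a corner. *)
Lemma sum_dF' d0 : ~~ bivalent d0 ->
  (\sum_(v in vertices (cells M) | #|v| != 2) dF' v
     = 2 * #|porbits (face (cells M))|%:R)%R.
Proof.
move=> ess_d0; rewrite [RHS]mulr_natl [RHS]mulr2n.
rewrite -{1}(sum_edge_length_left ess_d0).
rewrite -(sum_edge_length_right ess_d0) -big_split /= big_mkcondr.
rewrite [RHS]big_mkcond (sum_over_porbits (node (cells M))).
apply: eq_bigr => v /imsetP[x _ ->].
rewrite [RHS](eq_bigl (fun d => origin d == origin x)); last first.
  by move=> d; rewrite eq_porbit_mem.
rewrite -/(origin x); case: ifP => biv_x; last first.
  by rewrite big1 // => d /eqP dx; rewrite /bivalent dx biv_x.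
rewrite /dF'; apply: eq_big => d; first by rewrite eq_porbit_mem.
rewrite -eq_porbit_mem => /eqP dx; rewrite /bivalent [origin d]dx biv_x.
by rewrite !edge_length_glued relator_length_face mulrDl.
Qed.

(** Removing vertices of degree [2] does not change the sum of the [d(v) - 2],
    which is [2E - 2V]. *)
Lemma sum_degree :
  (\sum_(v in vertices (cells M) | #|v| != 2) ((degree v)%:R - 2)
     = 2 * (#|porbits (edge (cells M))|%:R - #|vertices (cells M)|%:R) :> rat)%R.
Proof.
rewrite big_mkcondr (eq_bigr (fun v : {set _} => #|v|%:R - 2)%R) => [|v _]; last first.
  by case: eqP => [->|//]; rewrite subrr.
rewrite sumrB sumr_const sum_card_porbits card_darts natrM.
by rewrite -[(2 *+ _)%R]mulr_natl -mulrBl mulrC.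
Qed.

Section AllBivalent.
Hypothesis biv : forall d, bivalent d.

Lemma iter_face_edge n d : iter n (face (cells M)) (edge (cells M) d)
  = edge (cells M) (iter n (face (cells M))^-1%g d).
Proof.
elim: n => //= n ->; set y := iter n _ d.
by rewrite -{1}[y](permKV (face (cells M))) face_edge_bivalent ?biv.
Qed.

Lemma face_of_edge d :
  face_of (edge (cells M) d) = [set edge (cells M) x | x in face_of d].
Proof.
apply/setP=> y; apply/porbitP/imsetP => [[n ->]|[x]].
  rewrite permX iter_face_edge; eexists; last by [].
  by rewrite /face_of -porbitV -permX mem_porbit.
rewrite /face_of -porbitV => /porbitP[n ->] ->.
by exists n; rewrite !permX iter_face_edge.
Qed.

(** The face to the right of [d] reads the circle of [d] backwards, with
    inverted letters. *)
Lemma boundary_word_edge d : boundary_word (@label P M) d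
  = winv (rot 1 (boundary_word (@label P M) (edge (cells M) d))).
Proof.
rewrite /boundary_word face_of_edge card_imset; last exact: perm_inj.
have: iter #|face_of d| (face (cells M)) d = d by exact: iter_porbit.
have: 0 < #|face_of d| by rewrite lt0n card_porbit_neq0.
case: #|face_of d| => // m _ fm.
have ->: traject (face (cells M)) (edge (cells M) d) m.+1
    = map (edge (cells M)) (traject (face (cells M))^-1%g d m.+1).
  apply: (@eq_from_nth _ d); rewrite size_traject ?size_map ?size_traject //.
  move=> i lt_im; rewrite (nth_map d) ?size_traject //.
  rewrite nth_traject // (set_nth_default (edge (cells M) d)) ?size_traject //.
  by rewrite nth_traject ?iter_face_edge.
rewrite /winv -!map_rot -!map_rev -!map_comp.
rewrite [in RHS]trajectS rot1_cons rev_rcons trajectS /=.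
have -> : (face (cells M))^-1%g d = iter m (face (cells M)) d.
  by rewrite -{1}fm iterS permK.
rewrite rev_traject; last exact: permK.
have labE x : linv (label (edge (cells M) x)) = label x.
  by rewrite label_edge /linv /= negbK; case: (label x).
by rewrite labE; congr cons; apply: eq_map => x /=; rewrite labE.
Qed.

(** Here [V = E], so Euler's formula leaves two faces, and connectedness yields
    an edge between them. *)
Lemma all_bivalent_reducible : reducible M.
Proof.
have VE : #|vertices (cells M)| = #|porbits (edge (cells M))|.
  have := card_porbits_2 (fun d => eqP (biv d)).
  by rewrite card_darts => /eqP; rewrite eqn_pmul2r // => /eqP.
have F2 : #|porbits (face (cells M))| = 2.
  have := sphere_euler (cells M).
  by rewrite -/(node _) -/(vertices _) VE => /eqP; rewrite eqn_add2l => /eqP.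
have [d dP|no_d] := pickP (fun d => face_of d != face_of (edge (cells M) d)).
  by exists d; split; rewrite ?not_removed //; apply: boundary_word_edge.
have all_eq x y : face_of x = face_of y.
  case/connectP: (sphere_connected x y) => p; elim: p x => [|z p IH] x /=.
    by move=> _ ->.
  case/andP=> xz zp yp; rewrite -(IH z zp yp).
  by case/orP: xz => /eqP->; [apply/eqP/negbFE/no_d | rewrite face_of_face].
have [A AF] : exists A, A \in porbits (face (cells M)).
  by apply/card_gt0P; rewrite F2.
have [x _ xA] := imsetP AF.
suff FA : porbits (face (cells M)) = [set A] by rewrite FA cards1 in F2.
apply/setP=> B; rewrite inE; apply/idP/eqP => [/imsetP[y _ ->]|-> //].
by rewrite xA; apply: all_eq.
Qed.

End AllBivalent.
End SphericalDiagram.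

Theorem theorem3p2 (P : presentation) (htau : tau' P)
  (hpow : no_proper_powers P) : DR P.
Proof.
move=> M sphM.
have [d0 ess_d0|all_biv] := pickP (fun d : dart (cells M) => ~~ bivalent d).
  (* The generators form an arbitrary type, so labels cannot be compared
     effectively and reducibility is obtained by contradiction. *)
  apply: NNPP => redM.
  have: (\sum_(v in vertices (cells M) | #|v| != 2) dF' v
         <= \sum_(v in vertices (cells M) | #|v| != 2) ((degree v)%:R - 2))%R.
    apply: ler_sum => v /andP[vV v2]; apply: htau => //.
    exact: interiorT.
  (* What remains is 2F <= 2E - 2V, against V + F = E + 2. *)
  rewrite (sum_dF' sphM ess_d0) sum_degree ler_pM2l // lerBrDr -!natrD ler_nat.
  rewrite addnC leqNgt => /negP; apply.
  by rewrite sphere_euler addn2 ltnS leqnSn.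
by apply: all_bivalent_reducible => // d; apply/negbFE/all_biv.
Qed.
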